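(* Let $q\in\mathbb{C}\setminus\{0\}$ and let $A$ be the quantum plane with its first order differential calculus $(A^1,d)$ and bimodule automorphism $\sigma$ of $A^1\otimes_AA^1$ as described in the context. If $q$ is not a root of unity, then the $\sigma$-compatible pairs $(\nabla^L,\nabla^R)$ of connections on $A^1$ are pairs of independent and unrestricted left and right connections; that is, for every left connection $\nabla^L$ on $A^1$ and every right connection $\nabla^R$ on $A^1$, the pair $(\nabla^L,\nabla^R)$ is $\sigma$-compatible.
   Context: $A$ is the unital complex algebra generated by $x,y$ with the relation $xy=qyx$. $A^1$ is the $A$-bimodule generated by $\xi=dx$ and $\eta=dy$ subject to $$x\xi=q^2\xi x,\quad x\eta=q\eta x+(q^2-1)\xi y,\quad y\xi=q\xi y,\quad y\eta=q^2\eta y;$$ it is free with basis $\{\xi,\eta\}$ both as a left and as a right $A$-module, and $d:A\to A^1$ is the derivation with $dx=\xi$, $dy=\eta$. $\sigma:A^1\otimes_AA^1\to A^1\otimes_AA^1$ is the bimodule automorphism determined by $$\sigma(\xi\otimes_A\xi)=q^{-2}\xi\otimes_A\xi,\quad \sigma(\xi\otimes_A\eta)=q^{-1}\eta\otimes_A\xi,$$ $$\sigma(\eta\otimes_A\xi)=q^{-1}\xi\otimes_A\eta-(1-q^{-2})\eta\otimes_A\xi,\quad \sigma(\eta\otimes_A\eta)=q^{-2}\eta\otimes_A\eta.$$ A left connection on $A^1$ is a linear map $\nabla^L:A^1\to A^1\otimes_AA^1$ with $\nabla^L(a\zeta)=da\otimes_A\zeta+a\nabla^L\zeta$; a right connection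 is a linear map $\nabla^R:A^1\to A^1\otimes_AA^1$ with $\nabla^R(\zeta a)=(\nabla^R\zeta)a+\zeta\otimes_Ada$ (for all $a\in A$, $\zeta\in A^1$). The pair $(\nabla^L,\nabla^R)$ is $\sigma$-compatible if $\nabla^L\zeta=(\sigma\circ\nabla^R)\zeta$ for all $\zeta\in Z(A^1)=\{\zeta\in A^1: a\zeta=\zeta a\ \ \forall a\in A\}$. *)

(* Defs.v *)
From HB Require Import structures.
From mathcomp Require Import all_boot all_order all_algebra.
From mathcomp Require Import ring_quotient boolp reals complex finmap.
From mathcomp Require Import monalg.

Set Implicit Arguments.
Unset Strict Implicit.
Unset Printing Implicit Defensive.

Import GRing.Theory.
Local Open Scope ring_scope.
Local Open Scope quotient_scope.

Inductive span (K : fieldType) (V : lmodType K) (S : V -> Prop) : V -> Prop :=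
| span0 : span S 0
| spanZD c s u : S s -> span S u -> span S (c *: s + u).

Section Span.
Context {K : fieldType} {V : lmodType K} (S : V -> Prop).

Lemma span_gen s : S s -> span S s.
Proof. by move=> Ss; rewrite -[s]addr0 -[s in s + _]scale1r; do 2?constructor. Qed.

Lemma spanD u v : span S u -> span S v -> span S (u + v).
Proof.
move=> Su Sv; elim: Su => [|c s w Ss _ IH]; first by rewrite add0r.
by rewrite -addrA; apply: spanZD.
Qed.

Lemma spanZ c u : span S u -> span S (c *: u).
Proof.
elim=> [|b s w Ss _ IH]; first by rewrite scaler0; apply: span0.
by rewrite scalerDr scalerA; apply: spanZD.
Qed.

End Span.

Lemma span_map (K : fieldType) (V W : lmodType K) (S : V -> Prop) (T : W -> Prop) (f : {linear V -> W}) :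
  (forall s, S s -> span T (f s)) -> forall u, span S u -> span T (f u).
Proof.
move=> fS u; elim=> [|c s w Ss _ IH]; first by rewrite linear0; apply: span0.
by rewrite linearP; apply: spanD => //; apply/spanZ/fS.
Qed.

Section LinearQuotient.
Context {K : fieldType} {V : lmodType K} (S : V -> Prop).

Definition in_span : {pred V} := fun v => `[< span S v >].

Lemma in_spanP v : reflect (span S v) (v \in in_span).
Proof. exact: asboolP. Qed.

Lemma in_span_zmod_closed : zmod_closed in_span.
Proof.
split; first by apply/in_spanP/span0.
move=> u v /in_spanP Su /in_spanP Sv; apply/in_spanP/spanD => //.
by rewrite -scaleN1r; apply: spanZ.
Qed.

HB.instance Definition _ := GRing.isZmodClosed.Build V in_span in_span_zmod_closed.

(* V / span S *)
Definition lquot : Type := Quotient.quot in_span.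

HB.instance Definition _ := Choice.on lquot.
HB.instance Definition _ := GRing.Zmodule.on lquot.

End LinearQuotient.

(* The operations below are locked to keep unification from unfolding them. *)
HB.lock Definition qproj (K : fieldType) (V : lmodType K) (S : V -> Prop)
  (v : V) : lquot S := \pi_(Quotient.quot (in_span S)) v.
Canonical qproj_unlockable := Unlockable qproj.unlock.
Arguments qproj {K V S} v.

HB.lock Definition qscale (K : fieldType) (V : lmodType K) (S : V -> Prop)
  (c : K) (p : lquot S) : lquot S := qproj (c *: repr p).
Canonical qscale_unlockable := Unlockable qscale.unlock.

(* The map induced by f on the quotient, meaningful when f kills S. *)
HB.lock Definition qlift (K : fieldType) (V : lmodType K) (S : V -> Prop)
  (W : Type) (f : V -> W) (p : lquot S) : W := f (repr p).
Canonical qlift_unlockable := Unlockable qlift.unlock.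
Arguments qlift {K V S W} f p.

Section LinearQuotientTheory.
Context {K : fieldType} {V : lmodType K} (S : V -> Prop).
Local Notation lquot := (lquot S).
Local Notation qproj := (@qproj K V S).
Local Notation qscale := (@qscale K V S).
Local Notation qlift := (@qlift K V S _).
Local Notation in_span := (in_span S).

Lemma qproj_zmod : zmod_morphism qproj.
Proof. by move=> u v; rewrite qproj.unlock raddfB. Qed.

Lemma qproj_eq u v : span S (u - v) -> qproj u = qproj v.
Proof. by move=> Suv; rewrite qproj.unlock; apply/eqP; rewrite -Quotient.idealrBE; apply/in_spanP. Qed.

Lemma qproj_span u v : qproj u = qproj v -> span S (u - v).
Proof. by rewrite qproj.unlock => /eqP; rewrite -Quotient.idealrBE => /in_spanP. Qed.

Lemma qreprK (p : lquot) : qproj (repr p) = p.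
Proof. by rewrite qproj.unlock; apply: reprK. Qed.

Lemma qreprB (v : V) : span S (repr (qproj v) - v).
Proof. by apply: qproj_span; rewrite qreprK. Qed.

HB.instance Definition _ := GRing.isZmodMorphism.Build V lquot qproj qproj_zmod.

Lemma qscaleE c v : qscale c (qproj v) = qproj (c *: v).
Proof.
by rewrite qscale.unlock; apply: qproj_eq; rewrite -scalerBr; apply/spanZ/qreprB.
Qed.

Lemma qscaleA a b p : qscale a (qscale b p) = qscale (a * b) p.
Proof. by rewrite -[p]qreprK !qscaleE scalerA. Qed.
Lemma qscale1 : left_id 1 qscale.
Proof. by move=> p; rewrite -[p]qreprK qscaleE scale1r. Qed.
Lemma qscaleDr : right_distributive qscale +%R.
Proof.
by move=> c p r; rewrite -[p]qreprK -[r]qreprK -raddfD !qscaleE scalerDr raddfD.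
Qed.
Lemma qscaleDl p : {morph qscale^~ p : a b / a + b}.
Proof. by move=> a b; rewrite -[p]qreprK !qscaleE scalerDl raddfD. Qed.

HB.instance Definition _ :=
  GRing.Zmodule_isLmodule.Build K lquot qscaleA qscale1 qscaleDr qscaleDl.

Lemma qproj_scalable : scalable qproj.
Proof. by move=> c v; rewrite -qscaleE. Qed.

HB.instance Definition _ := GRing.isScalable.Build K V lquot *:%R qproj qproj_scalable.

Lemma qliftE (W : lmodType K) (f : {linear V -> W}) v :
  (forall s, S s -> f s = 0) -> qlift f (qproj v) = f v.
Proof.
move=> fS; apply/eqP; rewrite qlift.unlock -subr_eq0 -linearB; apply/eqP.
elim: (qreprB v) => [|c s w Ss _ IH]; first exact: linear0.
by rewrite linearP IH fS // scaler0 addr0.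
Qed.

Lemma qlift_linear (W : lmodType K) (f : {linear V -> W}) :
  (forall s, S s -> f s = 0) -> linear (qlift f).
Proof.
move=> fS c p r; rewrite -[p]qreprK -[r]qreprK -linearP.
by rewrite !(qliftE _ fS) linearP.
Qed.

End LinearQuotientTheory.

(* The linear extension to {malg K[I]}, the free K-module on I, of a map on I. *)
HB.lock Definition free_ext (K : fieldType) (I : choiceType) (W : lmodType K)
  (h : I -> W) (g : {malg K[I]}) : W := \sum_(k <- msupp g) g@_k *: h k.
Canonical free_ext_unlockable := Unlockable free_ext.unlock.

Section FreeModule.
Context {K : fieldType} {I : choiceType}.
Implicit Types (W : lmodType K).

Lemma free_extEw W (h : I -> W) (D : {fset I}) (g : {malg K[I]}) :
  (msupp g `<=` D)%fset -> free_ext h g = \sum_(k <- D) g@_k *: h k.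
Proof.
move=> le; rewrite free_ext.unlock [LHS](big_fset_incl _ le) //= => k _ /mcoeff_outdom ->.
by rewrite scale0r.
Qed.

Lemma free_ext_linear W (h : I -> W) : linear (free_ext h).
Proof.
move=> c u v; pose D := (msupp u `|` msupp v)%fset.
have su : (msupp u `<=` D)%fset by apply: fsubsetUl.
have sv : (msupp v `<=` D)%fset by apply: fsubsetUr.
have sw : (msupp (c *: u + v) `<=` D)%fset.
  apply: fsubset_trans (msuppD_le _ _) _; rewrite fsubUset sv andbT.
  exact: fsubset_trans (msuppZ_le _ _) su.
rewrite !(@free_extEw _ _ D) // scaler_sumr -big_split /=.
by apply: eq_bigr => k _; rewrite mcoeffD mcoeffZ scalerDl scalerA.
Qed.

HB.instance Definition _ W (h : I -> W) :=
  GRing.isLinear.Build K {malg K[I]} W *:%R (free_ext h) (free_ext_linear h).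

Lemma free_extU W (h : I -> W) k : free_ext h << k >> = h k.
Proof.
by rewrite (free_extEw _ (@msuppU_le _ _ k 1)) big_seq_fset1 mcoeffUU scale1r.
Qed.

Lemma free_eq W (f1 f2 : {linear {malg K[I]} -> W}) :
  (forall k, f1 << k >> = f2 << k >>) -> f1 =1 f2.
Proof.
move=> f12 g; rewrite [g]monalgE !linear_sum; apply: eq_bigr => k _ /=.
have -> : << g@_k *g k >> = g@_k *: << k >> :> {malg K[I]}.
  by apply/malgP=> k'; rewrite mcoeffZ !mcoeffU mulrnAr mulr1.
by rewrite !linearZ /= f12.
Qed.

End FreeModule.

(* Bimodules over a K-algebra: K acts through the lmodType K structure, and
   bilinearity of both actions makes the two induced actions of K agree. *)
HB.mixin Record isBimodule (K : fieldType) (A : algType K) M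
    of GRing.Lmodule K M := {
  lact : A -> M -> M;
  ract : M -> A -> M;
  lact_linearl : forall m, linear (lact^~ m);
  lact_linearr : forall a, linear (lact a);
  ract_linearl : forall a, linear (ract^~ a);
  ract_linearr : forall m, linear (ract m);
  lact1 : forall m, lact 1 m = m;
  ract1 : forall m, ract m 1 = m;
  lactA : forall a b m, lact a (lact b m) = lact (a * b) m;
  ractA : forall m a b, ract (ract m a) b = ract m (a * b);
  lract : forall a m b, lact a (ract m b) = ract (lact a m) b;
}.

#[short(type="bimodType")]
HB.structure Definition Bimodule (K : fieldType) (A : algType K) :=
  {M of GRing.Lmodule K M & isBimodule K A M}.

Notation "a *> m" := (lact a m) (at level 40, m at next level) : ring_scope.
Notation "m <* a" := (ract m a) (at level 40, left associativity) : ring_scope.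

Section BimoduleTheory.
Context {K : fieldType} {A : algType K} {M : bimodType A}.
Implicit Types (a b : A) (m : M).

HB.instance Definition _ a :=
  GRing.isLinear.Build K M M *:%R (@lact K A M a) (lact_linearr a).
HB.instance Definition _ m :=
  GRing.isLinear.Build K A M *:%R (@ract K A M m) (ract_linearr m).

Definition ractr a m : M := m <* a.
Lemma ractrE a m : ractr a m = m <* a. Proof. by []. Qed.
HB.instance Definition _ a :=
  GRing.isLinear.Build K M M *:%R (ractr a) (ract_linearl a).

Lemma lactPr a c m m' : a *> (c *: m + m') = c *: (a *> m) + a *> m'.
Proof. exact: lact_linearr. Qed.
Lemma lactPl c a a' m : (c *: a + a') *> m = c *: (a *> m) + a' *> m.
Proof. exact: (lact_linearl m). Qed.
Lemma ractPl c m m' a : (c *: m + m') <* a = c *: (m <* a) + m' <* a.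
Proof. exact: (ract_linearl a). Qed.
Lemma ractPr m c a a' : m <* (c *: a + a') = c *: (m <* a) + m <* a'.
Proof. exact: ract_linearr. Qed.

End BimoduleTheory.

Section BimoduleQuotient.
Context {K : fieldType} {A : algType K} {M : bimodType A} (S : M -> Prop).

Definition sub_bimod_gen (v : M) : Prop :=
  exists a s b, S s /\ v = a *> s <* b.

(* M / A S A *)
Definition bquot : Type := lquot sub_bimod_gen.
HB.instance Definition _ := GRing.Lmodule.on bquot.

Definition bproj : M -> bquot := @qproj K M sub_bimod_gen.
HB.instance Definition _ := GRing.Linear.on bproj.

End BimoduleQuotient.

HB.lock Definition blact (K : fieldType) (A : algType K) (M : bimodType A)
  (S : M -> Prop) (a : A) (p : bquot S) : bquot S := bproj S (a *> repr p).
HB.lock Definition bract (K : fieldType) (A : algType K) (M : bimodType A)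
  (S : M -> Prop) (p : bquot S) (a : A) : bquot S := bproj S (repr p <* a).

Section BimoduleQuotientTheory.
Context {K : fieldType} {A : algType K} {M : bimodType A} (S : M -> Prop).
Local Notation bquot := (bquot S).
Local Notation bproj := (bproj S).
Local Notation blact := (@blact K A M S).
Local Notation bract := (@bract K A M S).

Lemma blactE a m : blact a (bproj m) = bproj (a *> m).
Proof.
rewrite blact.unlock; apply: qproj_eq; rewrite -linearB /=.
apply: (span_map (f := lact a)) (qreprB _ _) => _ [b [s [b' [Ss ->]]]] /=.
by apply: span_gen; exists (a * b), s, b'; rewrite lract lactA.
Qed.

Lemma bractE a m : bract (bproj m) a = bproj (m <* a).
Proof.
rewrite bract.unlock; apply: qproj_eq; rewrite -!ractrE -linearB.
apply: (span_map (f := ractr a)) (qreprB _ _) => _ [b [s [b' [Ss ->]]]].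
by apply: span_gen; exists b, s, (b' * a); rewrite /= ractrE ractA.
Qed.

Let bqP (p : bquot) : exists m, p = bproj m.
Proof. by exists (repr p); rewrite [RHS]qreprK. Qed.

Lemma blact_linearl p : linear (blact^~ p).
Proof.
by case: (bqP p) => m -> c a a'; rewrite !blactE lactPl linearP.
Qed.
Lemma blact_linearr a : linear (blact a).
Proof.
move=> c p r; case: (bqP p) (bqP r) => m -> [n ->].
by rewrite -linearP !blactE lactPr linearP.
Qed.
Lemma bract_linearl a : linear (bract^~ a).
Proof.
move=> c p r; case: (bqP p) (bqP r) => m -> [n ->].
by rewrite -linearP !bractE ractPl linearP.
Qed.
Lemma bract_linearr p : linear (bract p).
Proof.
by case: (bqP p) => m -> c a a'; rewrite !bractE ractPr linearP.
Qed.
Lemma blact1 p : blact 1 p = p.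
Proof. by case: (bqP p) => m ->; rewrite blactE lact1. Qed.
Lemma bract1 p : bract p 1 = p.
Proof. by case: (bqP p) => m ->; rewrite bractE ract1. Qed.
Lemma blactA a b p : blact a (blact b p) = blact (a * b) p.
Proof. by case: (bqP p) => m ->; rewrite !blactE lactA. Qed.
Lemma bractA p a b : bract (bract p a) b = bract p (a * b).
Proof. by case: (bqP p) => m ->; rewrite !bractE ractA. Qed.
Lemma blract a p b : blact a (bract p b) = bract (blact a p) b.
Proof. by case: (bqP p) => m ->; rewrite !(blactE, bractE) lract. Qed.

HB.instance Definition _ := isBimodule.Build K A bquot
  blact_linearl blact_linearr bract_linearl bract_linearr
  blact1 bract1 blactA bractA blract.

End BimoduleQuotientTheory.

Section Presentation.
Context {K : fieldType} {I : choiceType} (S : {malg K[I]} -> Prop).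

Lemma pres_eq (W : lmodType K) (f g : lquot S -> W) : linear f -> linear g ->
  (forall k, f (qproj << k >>) = g (qproj << k >>)) -> f =1 g.
Proof.
move=> f_lin g_lin fg p; rewrite -[p]qreprK.
pose f' := HB.pack_for {linear lquot S -> W} f (GRing.isLinear.Build _ _ _ _ f f_lin).
pose g' := HB.pack_for {linear lquot S -> W} g (GRing.isLinear.Build _ _ _ _ g g_lin).
exact: (@free_eq K I W (f' \o qproj) (g' \o qproj)).
Qed.

End Presentation.

Lemma lin_comp (K : fieldType) (U V W : lmodType K) (f : V -> W) (g : U -> V) :
  linear f -> linear g -> linear (fun p => f (g p)).
Proof. by move=> fl gl c u v; rewrite gl fl. Qed.

Lemma lin_comb (K : fieldType) (V W : lmodType K) (d : K) (f g : V -> W) :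
  linear f -> linear g -> linear (fun p => d *: f p + g p).
Proof.
move=> fl gl c u v; rewrite fl gl !scalerDr addrACA !scalerA.
by rewrite [d * c]mulrC.
Qed.

Lemma free_ext_rel (K : fieldType) (I : choiceType) (W : lmodType K)
    (h : I -> W) c i j k :
  free_ext h (<< i >> - (c *: << j >> + << k >>)) = h i - (c *: h j + h k).
Proof. by rewrite linearB linearP /= !free_extU. Qed.

Lemma free_extB (K : fieldType) (I : choiceType) (W : lmodType K)
    (h : I -> W) i j :
  free_ext h (<< i >> - << j >>) = h i - h j.
Proof. by rewrite linearB /= !free_extU. Qed.

Section FreeBimodule.
Context {K : fieldType} (A : algType K) (I : choiceType).

(* The free bimodule is the K-space spanned by the symbols a e_i b, written
   (a, i, b), subject to K-bilinearity in (a, b). *)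
Let sym a i b : {malg K[(A * I * A)%type]} := << (a, i, b) >>.

Inductive fbimod_rel : {malg K[(A * I * A)%type]} -> Prop :=
| fbimod_linl c a a' i b :
    fbimod_rel (sym (c *: a + a') i b - (c *: sym a i b + sym a' i b))
| fbimod_linr c a i b b' :
    fbimod_rel (sym a i (c *: b + b') - (c *: sym a i b + sym a i b')).

Definition fbimod : Type := lquot fbimod_rel.
HB.instance Definition _ := GRing.Lmodule.on fbimod.

Definition fbsym a i b : fbimod := qproj (sym a i b).

End FreeBimodule.

HB.lock Definition fblact (K : fieldType) (A : algType K) (I : choiceType)
  (a : A) : fbimod A I -> fbimod A I :=
  qlift (free_ext (fun k : A * I * A => fbsym (a * k.1.1) k.1.2 k.2)).
HB.lock Definition fbract (K : fieldType) (A : algType K) (I : choiceType)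
  (p : fbimod A I) (a : A) : fbimod A I :=
  qlift (free_ext (fun k : A * I * A => fbsym k.1.1 k.1.2 (k.2 * a))) p.

Section FreeBimoduleTheory.
Context {K : fieldType} (A : algType K) (I : choiceType).
Local Notation fbimod := (fbimod A I).
Local Notation fbimod_rel := (@fbimod_rel K A I).
Local Notation psym := (@fbsym K A I).
Local Notation fblact := (@fblact K A I).
Local Notation fbract := (@fbract K A I).

Lemma fbsymPl c a a' i b : psym (c *: a + a') i b = c *: psym a i b + psym a' i b.
Proof. by rewrite -!linearP; apply/qproj_eq/span_gen/fbimod_linl. Qed.
Lemma fbsymPr c a i b b' : psym a i (c *: b + b') = c *: psym a i b + psym a i b'.
Proof. by rewrite -!linearP; apply/qproj_eq/span_gen/fbimod_linr. Qed.

Let lact_sym a (k : A * I * A) : fbimod := psym (a * k.1.1) k.1.2 k.2.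
Let ract_sym a (k : A * I * A) : fbimod := psym k.1.1 k.1.2 (k.2 * a).

Let lact_sym_rel a s : fbimod_rel s -> free_ext (lact_sym a) s = 0.
Proof.
case=> [c b b' i d|c b i d d']; rewrite free_ext_rel /lact_sym /=.
  by rewrite mulrDr -scalerAr fbsymPl subrr.
by rewrite fbsymPr subrr.
Qed.
Let ract_sym_rel a s : fbimod_rel s -> free_ext (ract_sym a) s = 0.
Proof.
case=> [c b b' i d|c b i d d']; rewrite free_ext_rel /ract_sym /=.
  by rewrite fbsymPl subrr.
by rewrite mulrDl -scalerAl fbsymPr subrr.
Qed.

Lemma fblactE a b i c : fblact a (psym b i c) = psym (a * b) i c.
Proof. by rewrite fblact.unlock [LHS]qliftE /= ?free_extU //; apply: lact_sym_rel. Qed.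
Lemma fbractE a b i c : fbract (psym b i c) a = psym b i (c * a).
Proof. by rewrite fbract.unlock [LHS]qliftE /= ?free_extU //; apply: ract_sym_rel. Qed.

Lemma fblact_linearr a : linear (fblact a).
Proof. by rewrite fblact.unlock; exact: qlift_linear (@lact_sym_rel a). Qed.
Lemma fbract_linearl a : linear (fbract^~ a).
Proof. by rewrite fbract.unlock; exact: qlift_linear (@ract_sym_rel a). Qed.

Let fb_eq (f g : fbimod -> fbimod) : linear f -> linear g ->
  (forall a i b, f (psym a i b) = g (psym a i b)) -> f =1 g.
Proof. by move=> fl gl fg; apply: pres_eq => // -[[a i] b]; apply: fg. Qed.

Lemma fblact_linearl p : linear (fblact^~ p).
Proof.
move=> c a a'; move: p; apply: fb_eq => [||b i d].
- exact: fblact_linearr.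
- by apply: lin_comb; apply: fblact_linearr.
- by rewrite !fblactE mulrDl -scalerAl fbsymPl.
Qed.
Lemma fbract_linearr p : linear (fbract p).
Proof.
move=> c a a'; move: p; apply: fb_eq => [||b i d].
- exact: fbract_linearl.
- by apply: (lin_comb c (f := fbract^~ a) (g := fbract^~ a')); apply: fbract_linearl.
- by rewrite !fbractE mulrDr -scalerAr fbsymPr.
Qed.
Lemma fblact1 p : fblact 1 p = p.
Proof.
move: p; apply: fb_eq => [||b i d] //; first exact: fblact_linearr.
by rewrite fblactE mul1r.
Qed.
Lemma fbract1 p : fbract p 1 = p.
Proof.
move: p; apply: fb_eq => [||b i d] //; first exact: fbract_linearl.
by rewrite fbractE mulr1.
Qed.
Lemma fblactA a b p : fblact a (fblact b p) = fblact (a * b) p.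
Proof.
move: p; apply: fb_eq => [||c i d]; last by rewrite !fblactE mulrA.
  by apply: lin_comp; apply: fblact_linearr.
exact: fblact_linearr.
Qed.
Lemma fbractA p a b : fbract (fbract p a) b = fbract p (a * b).
Proof.
move: p; apply: fb_eq => [||c i d]; last by rewrite !fbractE mulrA.
  by apply: (lin_comp (f := fbract^~ b) (g := fbract^~ a)); apply: fbract_linearl.
exact: fbract_linearl.
Qed.
Lemma fblract a p b : fblact a (fbract p b) = fbract (fblact a p) b.
Proof.
move: p; apply: fb_eq => [||c i d]; last by rewrite !(fbractE, fblactE).
  by apply: (lin_comp (f := fblact a) (g := fbract^~ b));
    [apply: fblact_linearr | apply: fbract_linearl].
by apply: (lin_comp (f := fbract^~ b) (g := fblact a));
  [apply: fbract_linearl | apply: fblact_linearr].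
Qed.

HB.instance Definition _ := isBimodule.Build K A fbimod
  fblact_linearl fblact_linearr fbract_linearl fbract_linearr
  fblact1 fbract1 fblactA fbractA fblract.

End FreeBimoduleTheory.

HB.lock Definition fbimod_gen (K : fieldType) (A : algType K) (I : choiceType)
  (i : I) : fbimod A I := fbsym 1 i 1.

Section Tensor.
Context {K : fieldType} {A : algType K} (M N : bimodType A).

Let sym m n : {malg K[(M * N)%type]} := << (m, n) >>.

Inductive tensor_rel : {malg K[(M * N)%type]} -> Prop :=
| tensor_linl c m m' n :
    tensor_rel (sym (c *: m + m') n - (c *: sym m n + sym m' n))
| tensor_linr c m n n' :
    tensor_rel (sym m (c *: n + n') - (c *: sym m n + sym m n'))
| tensor_bal m a n : tensor_rel (sym (m <* a) n - sym m (a *> n)).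

Definition tensor : Type := lquot tensor_rel.
HB.instance Definition _ := GRing.Lmodule.on tensor.

Definition tens (m : M) (n : N) : tensor := qproj (sym m n).

End Tensor.

HB.lock Definition tlact (K : fieldType) (A : algType K) (M N : bimodType A)
  (a : A) : tensor M N -> tensor M N :=
  qlift (free_ext (fun k : M * N => tens (a *> k.1) k.2)).
HB.lock Definition tract (K : fieldType) (A : algType K) (M N : bimodType A)
  (p : tensor M N) (a : A) : tensor M N :=
  qlift (free_ext (fun k : M * N => tens k.1 (k.2 <* a))) p.

Section TensorTheory.
Context {K : fieldType} {A : algType K} (M N : bimodType A).
Local Notation tensor := (tensor M N).
Local Notation tensor_rel := (@tensor_rel K A M N).
Local Notation tens := (@tens K A M N).
Local Notation tlact := (@tlact K A M N).
Local Notation tract := (@tract K A M N).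

Lemma tensPl c m m' n : tens (c *: m + m') n = c *: tens m n + tens m' n.
Proof. by rewrite -!linearP; apply/qproj_eq/span_gen/tensor_linl. Qed.
Lemma tensPr c m n n' : tens m (c *: n + n') = c *: tens m n + tens m n'.
Proof. by rewrite -!linearP; apply/qproj_eq/span_gen/tensor_linr. Qed.
Lemma tens_bal m a n : tens (m <* a) n = tens m (a *> n).
Proof. by apply/qproj_eq/span_gen/tensor_bal. Qed.

Let lact_sym a (k : M * N) : tensor := tens (a *> k.1) k.2.
Let ract_sym a (k : M * N) : tensor := tens k.1 (k.2 <* a).

Let lact_sym_rel a s : tensor_rel s -> free_ext (lact_sym a) s = 0.
Proof.
case=> [c m m' n|c m n n'|m b n].
- by rewrite free_ext_rel /lact_sym /= lactPr tensPl subrr.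
- by rewrite free_ext_rel /lact_sym /= tensPr subrr.
- by rewrite free_extB /lact_sym /= lract tens_bal subrr.
Qed.
Let ract_sym_rel a s : tensor_rel s -> free_ext (ract_sym a) s = 0.
Proof.
case=> [c m m' n|c m n n'|m b n].
- by rewrite free_ext_rel /ract_sym /= tensPl subrr.
- by rewrite free_ext_rel /ract_sym /= ractPl tensPr subrr.
- by rewrite free_extB /ract_sym /= -lract tens_bal subrr.
Qed.

Lemma tlactE a m n : tlact a (tens m n) = tens (a *> m) n.
Proof. by rewrite tlact.unlock [LHS]qliftE /= ?free_extU //; apply: lact_sym_rel. Qed.
Lemma tractE a m n : tract (tens m n) a = tens m (n <* a).
Proof. by rewrite tract.unlock [LHS]qliftE /= ?free_extU //; apply: ract_sym_rel. Qed.

Lemma tlact_linearr a : linear (tlact a).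
Proof. by rewrite tlact.unlock; exact: qlift_linear (@lact_sym_rel a). Qed.
Lemma tract_linearl a : linear (tract^~ a).
Proof. by rewrite tract.unlock; exact: qlift_linear (@ract_sym_rel a). Qed.

Lemma tensor_eq (W : lmodType K) (f g : tensor -> W) : linear f -> linear g ->
  (forall m n, f (tens m n) = g (tens m n)) -> f =1 g.
Proof. by move=> fl gl fg; apply: pres_eq => // -[m n]; apply: fg. Qed.

Lemma tlact_linearl p : linear (tlact^~ p).
Proof.
move=> c a a'; move: p; apply: tensor_eq => [||m n].
- exact: tlact_linearr.
- by apply: lin_comb; apply: tlact_linearr.
- by rewrite !tlactE lactPl tensPl.
Qed.
Lemma tract_linearr p : linear (tract p).
Proof.
move=> c a a'; move: p; apply: tensor_eq => [||m n].
- exact: tract_linearl.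
- by apply: (lin_comb c (f := tract^~ a) (g := tract^~ a')); apply: tract_linearl.
- by rewrite !tractE ractPr tensPr.
Qed.
Lemma tlact1 p : tlact 1 p = p.
Proof.
move: p; apply: tensor_eq => [||m n] //; first exact: tlact_linearr.
by rewrite tlactE lact1.
Qed.
Lemma tract1 p : tract p 1 = p.
Proof.
move: p; apply: tensor_eq => [||m n] //; first exact: tract_linearl.
by rewrite tractE ract1.
Qed.
Lemma tlactA a b p : tlact a (tlact b p) = tlact (a * b) p.
Proof.
move: p; apply: tensor_eq => [||m n]; last by rewrite !tlactE lactA.
  by apply: lin_comp; apply: tlact_linearr.
exact: tlact_linearr.
Qed.
Lemma tractA p a b : tract (tract p a) b = tract p (a * b).
Proof.
move: p; apply: tensor_eq => [||m n]; last by rewrite !tractE ractA.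
  by apply: (lin_comp (f := tract^~ b) (g := tract^~ a)); apply: tract_linearl.
exact: tract_linearl.
Qed.
Lemma tlract a p b : tlact a (tract p b) = tract (tlact a p) b.
Proof.
move: p; apply: tensor_eq => [||m n]; last by rewrite !(tractE, tlactE).
  by apply: (lin_comp (f := tlact a) (g := tract^~ b));
    [apply: tlact_linearr | apply: tract_linearl].
by apply: (lin_comp (f := tract^~ b) (g := tlact a));
  [apply: tract_linearl | apply: tlact_linearr].
Qed.

HB.instance Definition _ := isBimodule.Build K A tensor
  tlact_linearl tlact_linearr tract_linearl tract_linearr
  tlact1 tract1 tlactA tractA tlract.

End TensorTheory.

Section AlgebraQuotient.
Context {K : fieldType} {F : algType K} (S : F -> Prop).

(* The two-sided ideal generated by S is the span of this. *)
Definition ideal_gen (f : F) : Prop := exists u s v, S s /\ f = u * s * v.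

Lemma ideal_genMl u v : span ideal_gen v -> span ideal_gen (u * v).
Proof.
elim=> [|c _ w [a [s [b [Ss ->]]]] _ IH]; first by rewrite mulr0; apply: span0.
rewrite mulrDr -scalerAr; apply: spanZD => //.
by exists (u * a), s, b; rewrite !mulrA.
Qed.
Lemma ideal_genMr u v : span ideal_gen v -> span ideal_gen (v * u).
Proof.
elim=> [|c _ w [a [s [b [Ss ->]]]] _ IH]; first by rewrite mul0r; apply: span0.
rewrite mulrDl -scalerAl; apply: spanZD => //.
by exists a, s, (b * u); rewrite !mulrA.
Qed.

(* algType requires 1 != 0, so the type carries a proof that the ideal is
   proper. *)
Definition aquot (S1 : ~ span ideal_gen 1) : Type := lquot ideal_gen.

Context (S1 : ~ span ideal_gen 1).
Local Notation Q := (aquot S1).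

HB.instance Definition _ := GRing.Lmodule.on Q.

Definition aproj (u : F) : Q := qproj u.
Lemma aproj_linear : linear aproj. Proof. exact: linearP. Qed.
HB.instance Definition _ := GRing.isLinear.Build K F Q *:%R aproj aproj_linear.

End AlgebraQuotient.

HB.lock Definition amul (K : fieldType) (F : algType K) (S : F -> Prop)
  (S1 : ~ span (ideal_gen S) 1) (a b : aquot S1) : aquot S1 :=
  aproj S1 (repr a * repr b).

Section AlgebraQuotientTheory.
Context {K : fieldType} {F : algType K} (S : F -> Prop).
Context (S1 : ~ span (ideal_gen S) 1).
Local Notation Q := (aquot S1).
Local Notation aproj := (aproj S1).
Local Notation amul := (@amul K F S S1).

Lemma amulE u v : amul (aproj u) (aproj v) = aproj (u * v).
Proof.
rewrite amul.unlock; apply: qproj_eq.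
rewrite -(subrK (u * repr (aproj v)) (_ * _)) -addrA -mulrBl -mulrBr.
by apply: spanD; [apply/ideal_genMr/qreprB | apply/ideal_genMl/qreprB].
Qed.

Lemma aprojP (a : Q) : exists u, a = aproj u.
Proof. by exists (repr a); rewrite /aproj qreprK. Qed.

Lemma amulA : associative amul.
Proof.
move=> a b c; have [u ->] := aprojP a; have [v ->] := aprojP b.
by have [w ->] := aprojP c; rewrite !amulE mulrA.
Qed.
Lemma amul1 : left_id (aproj 1) amul.
Proof. by move=> a; have [u ->] := aprojP a; rewrite amulE mul1r. Qed.
Lemma amulr1 : right_id (aproj 1) amul.
Proof. by move=> a; have [u ->] := aprojP a; rewrite amulE mulr1. Qed.
Lemma amulDl : left_distributive amul +%R.
Proof.
move=> a b c; have [u ->] := aprojP a; have [v ->] := aprojP b.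
by have [w ->] := aprojP c; rewrite -linearD !amulE mulrDl linearD.
Qed.
Lemma amulDr : right_distributive amul +%R.
Proof.
move=> a b c; have [u ->] := aprojP a; have [v ->] := aprojP b.
by have [w ->] := aprojP c; rewrite -linearD !amulE mulrDr linearD.
Qed.
Lemma aone_neq0 : aproj 1 != 0.
Proof.
apply/eqP; rewrite -(linear0 aproj) => /qproj_span.
by rewrite subr0; apply: S1.
Qed.

HB.instance Definition _ := GRing.Zmodule_isNzRing.Build Q
  amulA amul1 amulr1 amulDl amulDr aone_neq0.

Lemma ascaleAl (c : K) (a b : Q) : c *: (a * b) = c *: a * b.
Proof.
have [u ->] := aprojP a; have [v ->] := aprojP b.
rewrite -[c *: aproj u]linearZ.
change (c *: amul (aproj u) (aproj v) = amul (aproj (c *: u)) (aproj v)).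
by rewrite !amulE -linearZ /= scalerAl.
Qed.
HB.instance Definition _ := GRing.Lmodule_isLalgebra.Build K Q ascaleAl.

Lemma ascaleAr (c : K) (a b : Q) : c *: (a * b) = a * (c *: b).
Proof.
have [u ->] := aprojP a; have [v ->] := aprojP b.
rewrite -[c *: aproj v]linearZ.
change (c *: amul (aproj u) (aproj v) = amul (aproj u) (aproj (c *: v))).
by rewrite !amulE -linearZ /= scalerAr.
Qed.
HB.instance Definition _ := GRing.Lalgebra_isAlgebra.Build K Q ascaleAr.

Lemma aproj_monoid : monoid_morphism aproj.
Proof. by split=> // u v; rewrite -amulE. Qed.
HB.instance Definition _ := GRing.isMonoidMorphism.Build F Q aproj aproj_monoid.

Lemma aproj0 s : S s -> aproj s = 0.
Proof.
move=> Ss; rewrite -(linear0 aproj); apply/qproj_eq/span_gen; rewrite subr0.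
by exists 1, s, 1; rewrite mul1r mulr1.
Qed.

Lemma aproj_qcomm c u v : S (u * v - c *: (v * u)) ->
  aproj u * aproj v = c *: (aproj v * aproj u).
Proof.
move=> /aproj0; rewrite linearB linearZ !rmorphM /= => /eqP.
by rewrite subr_eq0 => /eqP.
Qed.

End AlgebraQuotientTheory.

Lemma malg_scaleAr (K : fieldType) (M : monomType) (c : K) (u v : {malg K[M]}) :
  c *: (u * v) = u * (c *: v).
Proof.
apply/malgP => k; rewrite mcoeffZ mcoeffMl.
rewrite [RHS](mcoeffMlw k (d1 := msupp u) (d2 := msupp v)) //; last exact: msuppZ_le.
rewrite mulr_sumr; apply: eq_bigr => i _; rewrite mulr_sumr.
by apply: eq_bigr => j _; rewrite mcoeffZ mulrnAr mulrCA.
Qed.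

Lemma rmorph_qcomm (K : fieldType) (F : algType K) (phi : {rmorphism F -> K})
    (phiZ : forall c u, phi (c *: u) = c * phi u) c u v :
  phi u = 0 -> phi (u * v - c *: (v * u)) = 0.
Proof. by move=> u0; rewrite rmorphB phiZ !rmorphM u0 mul0r !mulr0 subr0. Qed.

Section FreeAlgebra.
Context (K : fieldType) (I : choiceType).

(* The free algebra on I is the algebra of the free monoid on I. *)
Definition falg : Type := {malg K[{fmonom I}]}.
HB.instance Definition _ := GRing.Lalgebra.on falg.

HB.instance Definition _ := GRing.Lalgebra_isAlgebra.Build K falg
  (@malg_scaleAr K {fmonom I}).

End FreeAlgebra.

HB.lock Definition falg_gen (K : fieldType) (I : choiceType) (i : I)
  : falg K I := << fmu i >>.

Section FreeAlgebraTheory.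
Context {K : fieldType} {I : choiceType}.
Local Notation falg := (falg K I).
Local Notation falg_gen := (@falg_gen K I).

Definition falg_const : falg -> K := mcoeff mone.
HB.instance Definition _ := GRing.RMorphism.on falg_const.

Lemma falg_constZ c u : falg_const (c *: u) = c * falg_const u.
Proof. exact: mcoeffZ. Qed.
Lemma falg_const_gen i : falg_const (falg_gen i) = 0.
Proof. by rewrite /falg_const falg_gen.unlock mcoeffU -val_eqE /= fmU fm1. Qed.

Lemma falg_const_qcomm c i j :
  falg_const (falg_gen i * falg_gen j - c *: (falg_gen j * falg_gen i)) = 0.
Proof.
apply: (@rmorph_qcomm K falg falg_const); first exact: falg_constZ.
exact: falg_const_gen.
Qed.

Lemma ideal_proper (S : falg -> Prop) :
  (forall s, S s -> falg_const s = 0) -> ~ span (ideal_gen S) 1.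
Proof.
move=> S0 s1; suff: falg_const 1 = 0.
  by move/eqP; rewrite rmorph1 oner_eq0.
elim: s1 => [|c _ w [a [s [b [Ss ->]]]] _ IH]; first exact: rmorph0.
by rewrite rmorphD /= IH falg_constZ !rmorphM /= (S0 s) // mulr0 mul0r mulr0 addr0.
Qed.

End FreeAlgebraTheory.

Section QuantumPlane.
Context {K : fieldType} (q : K).

(* The letters false and true stand for x and y, and likewise for xi and eta. *)
Let fx : falg K bool := falg_gen K false.
Let fy : falg K bool := falg_gen K true.

Inductive qplane_rel : falg K bool -> Prop :=
| rel_x_y : qplane_rel (fx * fy - q *: (fy * fx)).

Lemma qplane_proper : ~ span (ideal_gen qplane_rel) 1.
Proof. by apply: ideal_proper => _ []; apply: falg_const_qcomm. Qed.

Definition qplane : Type := aquot qplane_proper.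
HB.instance Definition _ := GRing.Algebra.on qplane.

End QuantumPlane.

HB.lock Definition qx (K : fieldType) (q : K) : qplane q :=
  aproj (@qplane_proper K q) (falg_gen K false).
HB.lock Definition qy (K : fieldType) (q : K) : qplane q :=
  aproj (@qplane_proper K q) (falg_gen K true).

Lemma qxy (K : fieldType) (q : K) : qx q * qy q = q *: (qy q * qx q).
Proof. by rewrite qx.unlock qy.unlock; apply: aproj_qcomm (rel_x_y q). Qed.

Section QuantumPlaneForms.
Context {K : fieldType} (q : K).

Let x : qplane q := qx q.
Let y : qplane q := qy q.
Let fxi : fbimod (qplane q) bool := fbimod_gen (qplane q) false.
Let feta : fbimod (qplane q) bool := fbimod_gen (qplane q) true.

Inductive qform_rel : fbimod (qplane q) bool -> Prop :=
| rel_x_xi : qform_rel (x *> fxi - q ^+ 2 *: (fxi <* x))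
| rel_x_eta : qform_rel
    (x *> feta - (q *: (feta <* x) + (q ^+ 2 - 1) *: (fxi <* y)))
| rel_y_xi : qform_rel (y *> fxi - q *: (fxi <* y))
| rel_y_eta : qform_rel (y *> feta - q ^+ 2 *: (feta <* y)).

Definition qform : Type := bquot qform_rel.
HB.instance Definition _ := Bimodule.on qform.

End QuantumPlaneForms.

HB.lock Definition qxi (K : fieldType) (q : K) : qform q :=
  bproj (@qform_rel K q) (fbimod_gen (qplane q) false).
HB.lock Definition qeta (K : fieldType) (q : K) : qform q :=
  bproj (@qform_rel K q) (fbimod_gen (qplane q) true).

Section Connections.
Context {K : fieldType} {A : algType K} {M : bimodType A}.
Implicit Types (a b : A) (z : M).

Definition derivation (d : A -> M) : Prop :=
  forall a b, d (a * b) = d a <* b + a *> d b.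

Definition left_connection (d : A -> M) (nablaL : M -> tensor M M) : Prop :=
  linear nablaL /\
  forall a z, nablaL (a *> z) = tens (d a) z + a *> nablaL z.

Definition right_connection (d : A -> M) (nablaR : M -> tensor M M) : Prop :=
  linear nablaR /\
  forall z a, nablaR (z <* a) = nablaR z <* a + tens z (d a).

Definition bimod_center z : Prop := forall a, a *> z = z <* a.

Definition compatible (sigma : tensor M M -> tensor M M)
    (nablaL nablaR : M -> tensor M M) : Prop :=
  forall z, bimod_center z -> nablaL z = (sigma \o nablaR) z.

End Connections.

Definition bimod_automorphism (K : fieldType) (A : algType K) (T : bimodType A)
    (f : T -> T) : Prop :=
  [/\ linear f, bijective f, forall a t, f (a *> t) = a *> f t
    & forall t a, f (t <* a) = f t <* a].

Section QuantumPlaneCalculus.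
Context {K : fieldType} (q : K).

Definition qdifferential (d : qplane q -> qform q) : Prop :=
  [/\ linear d, derivation d, d (qx q) = qxi q & d (qy q) = qeta q].

Definition qbraiding
    (sigma : tensor (qform q) (qform q) -> tensor (qform q) (qform q)) : Prop :=
  let xi := qxi q in let eta := qeta q in
  [/\ bimod_automorphism sigma,
      sigma (tens xi xi) = q ^- 2 *: tens xi xi,
      sigma (tens xi eta) = q^-1 *: tens eta xi,
      sigma (tens eta xi)
        = q^-1 *: tens xi eta - (1 - q ^- 2) *: tens eta xi
    & sigma (tens eta eta) = q ^- 2 *: tens eta eta].

End QuantumPlaneCalculus.

(* Main.v *)
(* The center of the bimodule of forms is zero, so compatibility holds trivially.
   Write z = xi f + eta g. Comparing coefficients in x z = z x gives
   q (x g) = g x and q^2 (x f) + (q^2 - 1) (y g) = f x. On monomials,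
   q^k x (y^i x^j) = q^(k+i) (y^i x^j) x, so if q is not a root of unity then
   q^k (x a) = a x with k > 0 forces a = 0; hence g = 0, and then f = 0.
   Comparing coefficients requires the linear independence of the monomials
   y^i x^j and the freeness of the right module of forms on xi, eta; both are
   obtained by mapping the presented object to an explicit model. *)
Require Import Defs.
From HB Require Import structures.
From mathcomp Require Import all_boot all_order all_algebra.
From mathcomp Require Import boolp reals complex finmap.
From mathcomp Require Import monalg.

Set Implicit Arguments.
Unset Strict Implicit.
Unset Printing Implicit Defensive.

Import GRing.Theory.
Local Open Scope ring_scope.

(** * Linear preliminaries, and the free algebra acting on a vector space *)

Lemma lin0 (K : fieldType) (V W : lmodType K) (f : V -> W) : linear f -> f 0 = 0.
Proof.
by move=> fl; have := fl (-1) 0 0; rewrite scaler0 addr0 scaleN1r addNr.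
Qed.

Lemma mulPl (K : fieldType) (A : algType K) c (a b d : A) :
  (c *: a + b) * d = c *: (a * d) + b * d.
Proof. by rewrite mulrDl -scalerAl. Qed.

Lemma mulPr (K : fieldType) (A : algType K) c (a b d : A) :
  d * (c *: a + b) = c *: (d * a) + d * b.
Proof. by rewrite mulrDr -scalerAr. Qed.

Lemma malgUM (K : fieldType) (M : monomType) (k l : M) :
  << k >> * << l >> = << mmul k l >> :> {malg K[M]}.
Proof. by rewrite malgM_def fgmulUU mulr1. Qed.

Lemma malgU_ind (K : fieldType) (I : choiceType) (P : {malg K[I]} -> Prop) :
  P 0 -> (forall c u v, P u -> P v -> P (c *: u + v)) ->
  (forall k, P << k >>) -> forall u, P u.
Proof.
move=> P0 PD PU u; rewrite [u]monalgE.
elim: (enum_fset (msupp u)) => [|k r IH]; first by rewrite big_nil.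
rewrite big_cons; have -> : << u@_k *g k >> = u@_k *: << k >> :> {malg K[I]}.
  by apply/malgP=> k'; rewrite mcoeffZ !mcoeffU mulrnAr mulr1.
exact: PD.
Qed.

Lemma falgU_cons (K : fieldType) (I : choiceType) (i : I) (s : seq I) :
  << FMonom (i :: s) >> = falg_gen K i * << FMonom s >> :> falg K I.
Proof.
rewrite falg_gen.unlock [RHS]malgUM; congr << _ >>.
by apply/eqP; rewrite -val_eqE /= fmuE [mmul _ _]fmmulE.
Qed.

Lemma falgU_nil (K : fieldType) (I : choiceType) :
  << FMonom [::] >> = 1 :> falg K I.
Proof. by rewrite -[FMonom _]fmoneE. Qed.

(** Words are peeled from the left, one letter at a time, which matches the way left actions are
    computed. *)
Lemma falg_ind (K : fieldType) (I : choiceType) (P : falg K I -> Prop) :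
  P 0 -> P 1 -> (forall c u v, P u -> P v -> P (c *: u + v)) ->
  (forall i u, P u -> P (falg_gen K i * u)) -> forall u, P u.
Proof.
move=> P0 P1 PD PM; apply: (@malgU_ind K {fmonom I}) => // -[s].
elim: s => [|i s IH]; first by rewrite falgU_nil.
by rewrite falgU_cons; apply: PM.
Qed.

(** The vector comes before the algebra element: with [v] fixed this is a linear map on the free
    algebra, the form that [qlift] needs to descend to a quotient. *)
HB.lock Definition falg_act (K : fieldType) (I : choiceType) (V : lmodType K)
  (T : I -> {linear V -> V}) (v : V) : falg K I -> V :=
  free_ext (fun m : {fmonom I} => foldr (fun i => T i) v m).

Section FreeAlgebraAction.
Context {K : fieldType} {I : choiceType} {V : lmodType K}.
Context (T : I -> {linear V -> V}).
Local Notation falg_act := (@falg_act K I V T).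

Lemma falg_act_linearl v : linear (falg_act v).
Proof. by rewrite falg_act.unlock => c u w; apply: linearP. Qed.

HB.instance Definition _ v :=
  GRing.isLinear.Build K (falg K I) V *:%R (falg_act v) (falg_act_linearl v).

Lemma falg_actP v c u w :
  falg_act v (c *: u + w) = c *: falg_act v u + falg_act v w.
Proof. exact: falg_act_linearl. Qed.

Lemma falg_actU v s :
  falg_act v << FMonom s >> = foldr (fun i => T i) v s.
Proof. by rewrite falg_act.unlock free_extU. Qed.

Lemma falg_act1 v : falg_act v 1 = v.
Proof. by rewrite -falgU_nil falg_actU. Qed.

Lemma falg_act_gen i u v : falg_act v (falg_gen K i * u) = T i (falg_act v u).
Proof.
elim/(@malgU_ind K {fmonom I}): u => [|c u w IHu IHw|[s]].
- by rewrite mulr0 !linear0.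
- rewrite (mulPr (A := falg K I)) !falg_actP linearP.
  by congr (_ *: _ + _); [apply: IHu | apply: IHw].
- by rewrite -falgU_cons !falg_actU.
Qed.

Lemma falg_actM u w v : falg_act v (u * w) = falg_act (falg_act v w) u.
Proof.
elim/falg_ind: u => [||c u u' IHu IHu'|i u IHu].
- by rewrite mul0r !linear0.
- by rewrite mul1r falg_act1.
- rewrite mulPl !falg_actP.
  by congr (_ *: _ + _); [apply: IHu | apply: IHu'].
- by rewrite -mulrA !falg_act_gen IHu.
Qed.

Lemma falg_act_linear u : linear (falg_act^~ u).
Proof.
move=> c v w; elim/falg_ind: u => [||b u u' IHu IHu'|i u IHu].
- have act0 z : falg_act z 0 = 0 by apply: linear0.
  by rewrite !act0 scaler0 addr0.
- by rewrite !falg_act1.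
- by rewrite !falg_actP IHu IHu' !scalerDr addrACA !scalerA [b * c]mulrC.
- by rewrite !falg_act_gen IHu linearP.
Qed.

Lemma falg_act0 u : falg_act 0 u = 0.
Proof.
elim/falg_ind: u => [||b u u' IHu IHu'|i u IHu].
- exact: linear0.
- exact: falg_act1.
- by rewrite falg_actP IHu IHu' scaler0 addr0.
- by rewrite falg_act_gen IHu linear0.
Qed.

End FreeAlgebraAction.

(** * Representations of the quantum plane *)

Section QuantumPlaneAction.
Context {K : fieldType} {q : K}.

Lemma qplaneP (a : qplane q) : exists u, a = aproj (@qplane_proper K q) u.
Proof. exact: (aprojP (S1 := @qplane_proper K q)). Qed.

(** The projection from the free algebra is surjective and multiplicative, so induction on words
    descends to the quotient. *)
Lemma qplane_ind (P : qplane q -> Prop) :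
  P 0 -> P 1 -> (forall c a b, P a -> P b -> P (c *: a + b)) ->
  (forall a, P a -> P (qx q * a)) -> (forall a, P a -> P (qy q * a)) ->
  forall a, P a.
Proof.
move=> P0 P1 PD Px Py a; have [u ->] := qplaneP a.
elim/falg_ind: u => [||c u v IHu IHv|[] u IHu].
- by rewrite linear0.
- exact: P1.
- by rewrite linearP; apply: PD.
- by rewrite rmorphM; move: (Py _ IHu); rewrite qy.unlock.
- by rewrite rmorphM; move: (Px _ IHu); rewrite qx.unlock.
Qed.

Context {V : lmodType K} (X Y : {linear V -> V}).
Hypothesis XY : forall v, X (Y v) = q *: Y (X v).

Let T (b : bool) : {linear V -> V} := if b then Y else X.

(** Two operators with X Y = q Y X amount to a left module structure on [V]. The value is computed
    on a representative of [a]; [act_rel] makes the choice immaterial. *)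
Definition qact (a : qplane q) (v : V) : V := qlift (falg_act T v) a.

(** For u r w with relator r, the factor w only changes the vector, r then acts as X Y - q Y X = 0,
    and u sends 0 to 0. *)
Let act_rel v s : ideal_gen (@qplane_rel K q) s -> falg_act T v s = 0.
Proof.
case=> u [_ [w [[] ->]]].
have gen i z : falg_act T z (falg_gen K i) = T i z.
  by rewrite -[falg_gen K i]mulr1 falg_act_gen falg_act1.
rewrite (falg_actM T (u * _) w) (falg_actM T u) linearB linearZ /=.
have gen2 i j z : falg_act T z (falg_gen K i * falg_gen K j) = T i (T j z).
  by rewrite falg_act_gen; congr (T i _); apply: gen.
apply: etrans (falg_act0 T u); congr (falg_act T _ u).
move: (falg_act T v w) => z; apply/eqP; rewrite subr_eq0; apply/eqP.
apply: etrans (gen2 _ _ _) _; apply: etrans (XY z) _.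
by congr (_ *: _); symmetry; apply: gen2.
Qed.

Lemma qactE u v : qact (aproj (@qplane_proper K q) u) v = falg_act T v u.
Proof. exact/qliftE/act_rel. Qed.

Lemma qact_linearl v : linear (qact^~ v).
Proof. exact/qlift_linear/act_rel. Qed.

Lemma qact_linearr a : linear (qact a).
Proof.
by have [u ->] := qplaneP a => c v w; rewrite !qactE falg_act_linear.
Qed.

Lemma qact1 v : qact 1 v = v.
Proof. by rewrite -(rmorph1 (aproj (@qplane_proper K q))) qactE falg_act1. Qed.

Lemma qactM a b v : qact (a * b) v = qact a (qact b v).
Proof.
have [u ->] := qplaneP a; have [w ->] := qplaneP b.
by rewrite -rmorphM !qactE falg_actM.
Qed.

Lemma qact_x v : qact (qx q) v = X v.
Proof.
by rewrite qx.unlock qactE -[falg_gen K false]mulr1 falg_act_gen falg_act1.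
Qed.

Lemma qact_y v : qact (qy q) v = Y v.
Proof.
by rewrite qy.unlock qactE -[falg_gen K true]mulr1 falg_act_gen falg_act1.
Qed.

End QuantumPlaneAction.

(** * The monomial basis of the quantum plane, and twisted commutation with x *)

Section PBW.
Context {K : fieldType} (q : K).
Local Notation A := (qplane q).
Local Notation x := (qx q).
Local Notation y := (qy q).

Local Notation V := {malg K[(nat * nat)%type]}.
Local Notation e i j := (<< (i, j) >> : V).

(* The basis vector e i j models the monomial y^i x^j. *)
Definition pbw_x : {linear V -> V} :=
  free_ext (fun k : nat * nat => q ^+ k.1 *: e k.1 k.2.+1).
Definition pbw_y : {linear V -> V} :=
  free_ext (fun k : nat * nat => e k.1.+1 k.2).
(** Multiplying y^i x^j by x on the right needs no reordering, so the power of q seen in [pbw_x] is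
    absent. *)
Definition pbw_rx : {linear V -> V} :=
  free_ext (fun k : nat * nat => e k.1 k.2.+1).

Lemma pbw_xy v : pbw_x (pbw_y v) = q *: pbw_y (pbw_x v).
Proof.
elim/malgU_ind: v => [|c u v IHu IHv|[i j]].
- by rewrite !linear0.
- by rewrite !linearP /= IHu IHv.
- by rewrite /= !free_extU /= linearZ /= free_extU scalerA exprS.
Qed.

Definition pbw_mon : V -> A := free_ext (fun k : nat * nat => y ^+ k.1 * x ^+ k.2).
HB.instance Definition _ := GRing.Linear.on pbw_mon.

(** Coordinates are read off by acting on one cyclic vector, because y^i x^j carries [e 0 0] to
    [e i j]. *)
Definition pbw_coord (a : A) : V := qact pbw_x pbw_y a (e 0 0).

Lemma qx_ypow i : x * y ^+ i = q ^+ i *: (y ^+ i * x).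
Proof.
elim: i => [|i IH]; first by rewrite !expr0 mul1r mulr1 scale1r.
rewrite exprS mulrA qxy -scalerAl -!mulrA IH -scalerAr scalerA.
by rewrite -exprS.
Qed.

Lemma pbw_mon_x v : x * pbw_mon v = pbw_mon (pbw_x v).
Proof.
elim/malgU_ind: v => [|c u v IHu IHv|[i j]].
- by rewrite !linear0 mulr0.
- by rewrite !linearP mulPr IHu IHv.
- rewrite /= /pbw_mon !free_extU linearZ /= free_extU /= mulrA qx_ypow.
  by rewrite -scalerAl -mulrA -exprS.
Qed.

Lemma pbw_mon_y v : y * pbw_mon v = pbw_mon (pbw_y v).
Proof.
elim/malgU_ind: v => [|c u v IHu IHv|[i j]].
- by rewrite !linear0 mulr0.
- by rewrite !linearP mulPr IHu IHv.
- by rewrite /= /pbw_mon !free_extU /= mulrA -exprS.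
Qed.

Lemma pbw_mon_rx v : pbw_mon v * x = pbw_mon (pbw_rx v).
Proof.
elim/malgU_ind: v => [|c u v IHu IHv|[i j]].
- by rewrite !linear0 mul0r.
- by rewrite !linearP mulPl IHu IHv.
- by rewrite /= /pbw_mon !free_extU /= -mulrA -exprSr.
Qed.

(** The span of the monomials contains 1 and is stable under left multiplication by x and by y. *)
Lemma pbw_mon_surj a : exists v, a = pbw_mon v.
Proof.
elim/(@qplane_ind K q): a => [||c a b [v ->] [w ->]|a [v ->]|a [v ->]].
- by exists 0; rewrite linear0.
- by exists (e 0 0); rewrite /pbw_mon free_extU /= mulr1.
- by exists (c *: v + w); rewrite linearP.
- by exists (pbw_x v); rewrite pbw_mon_x.
- by exists (pbw_y v); rewrite pbw_mon_y.
Qed.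

(** This is the linear independence of the monomials: the left inverse separates them. *)
Lemma pbw_monK : cancel pbw_mon pbw_coord.
Proof.
have coordP c a b : pbw_coord (c *: a + b) = c *: pbw_coord a + pbw_coord b.
  exact: qact_linearl pbw_xy _ _ _ _.
elim/malgU_ind => [|c u v IHu IHv|[i j]].
- by rewrite linear0; apply: lin0.
- by rewrite linearP coordP IHu IHv.
rewrite /pbw_mon free_extU /= /pbw_coord (qactM pbw_xy).
(* The powers of x act first, on vectors with first index 0, where the factor of [pbw_x] is q^0 =
   1. *)
have -> : qact pbw_x pbw_y (x ^+ j) (e 0 0) = e 0 j.
  elim: j => [|j IH]; first by rewrite expr0 (qact1 pbw_xy).
  by rewrite exprS (qactM pbw_xy) IH (qact_x pbw_xy) /= free_extU /= scale1r.
elim: i => [|i IH]; first by rewrite expr0 (qact1 pbw_xy).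
by rewrite exprS (qactM pbw_xy) IH (qact_y pbw_xy) /= free_extU.
Qed.

(** Positivity of k keeps the exponent k + i positive even at i = 0; with k = 0 the powers of x
    would be nonzero solutions. *)
Lemma qcommx_eq0 k : (forall n, (0 < n)%N -> q ^+ n != 1) -> (0 < k)%N ->
  forall a : A, q ^+ k *: (x * a) = a * x -> a = 0.
Proof.
move=> qn k_gt0 a; have [v ->] := pbw_mon_surj a.
rewrite pbw_mon_x pbw_mon_rx => E.
(* [D], below, sends [e i j] to [(q ^+ (k + i) - 1) *: e i j.+1], so [L] is a
   left inverse of it. *)
pose L : {linear V -> V} := free_ext (fun k' : nat * nat =>
  if k'.2 is j.+1 then (q ^+ (k + k'.1) - 1)^-1 *: e k'.1 j else 0).
pose D w : V := q ^+ k *: pbw_x w - pbw_rx w.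
have D_lin : linear D.
  move=> c u w; rewrite /D !(linearP pbw_x) !(linearP pbw_rx) scalerBr scalerDr.
  by rewrite opprD addrACA !scalerA [_ * c]mulrC.
suff DK w : L (D w) = w.
  suff D0 : D v = 0 by rewrite -[v]DK D0 !linear0.
  (* [pbw_mon] sends [D v] to the difference of the two sides of [E], and it is injective. *)
  by apply: (can_inj pbw_monK); rewrite linearB linearZ /= E subrr linear0.
elim/malgU_ind: w => [|c u w IHu IHw|[i j]].
- by rewrite (lin0 D_lin) linear0.
- by rewrite D_lin linearP IHu IHw.
(* [D] raises the exponent of x by one, so the default value 0 of [L] is never met here. *)
- rewrite /D linearB linearZ /= !free_extU linearZ /= !free_extU /= scalerA -exprD.
  rewrite -[X in _ - X]scale1r -scalerBl scalerA mulfV ?scale1r //.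
  by rewrite subr_eq0 qn // addn_gt0 k_gt0.
Qed.

End PBW.

(** * Universal properties of free and quotient bimodules *)

Section BimoduleMaps.
Context {K : fieldType} {A : algType K}.

Definition fbimod_lift (I : choiceType) (N : bimodType A) (n : I -> N) :
    fbimod A I -> N :=
  qlift (free_ext (fun k : A * I * A => k.1.1 *> n k.1.2 <* k.2)).

Section FreeBimoduleLift.
Context {I : choiceType} {N : bimodType A} (n : I -> N).
Local Notation lift := (fbimod_lift n).

Let lift_rel s : @fbimod_rel K A I s ->
  free_ext (fun k : A * I * A => k.1.1 *> n k.1.2 <* k.2) s = 0.
Proof.
case=> [c b b' i d|c b i d d']; rewrite free_ext_rel /=.
  by rewrite lactPl ractPl subrr.
by rewrite ractPr subrr.
Qed.

Lemma fbimod_lift_linear : linear lift.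
Proof. exact/qlift_linear/lift_rel. Qed.

HB.instance Definition _ :=
  GRing.isLinear.Build K (fbimod A I) N *:%R lift fbimod_lift_linear.

Lemma fbimod_liftE a i b : lift (fbsym a i b) = a *> n i <* b.
Proof. by apply: etrans (qliftE _ lift_rel) _; rewrite /= free_extU. Qed.

Lemma fbimod_lift_lact a u : lift (a *> u) = a *> lift u.
Proof.
move: u; apply: pres_eq => [||[[b i] d]].
- exact: lin_comp fbimod_lift_linear (lact_linearr a).
- exact: lin_comp (lact_linearr a) fbimod_lift_linear.
- by rewrite [a *> _]fblactE !fbimod_liftE -lactA lract.
Qed.

Lemma fbimod_lift_ract a u : lift (u <* a) = lift u <* a.
Proof.
move: u; apply: pres_eq => [||[[b i] d]].
- exact: lin_comp fbimod_lift_linear (ract_linearl a).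
- exact: lin_comp (ract_linearl a) fbimod_lift_linear.
- by rewrite [_ <* a]fbractE !fbimod_liftE ractA.
Qed.

Lemma fbimod_lift_gen i : lift (fbimod_gen A i) = n i.
Proof. by rewrite fbimod_gen.unlock fbimod_liftE lact1 ract1. Qed.

End FreeBimoduleLift.

Lemma fbimod_ind (I : choiceType) (P : fbimod A I -> Prop) :
  P 0 -> (forall c u v, P u -> P v -> P (c *: u + v)) ->
  (forall a i b, P (a *> fbimod_gen A i <* b)) -> forall u, P u.
Proof.
move=> P0 PD PU u; rewrite -[u]qreprK.
elim/malgU_ind: (repr u) => [|c v w Pv Pw|[[a i] b]].
- by rewrite linear0.
- by rewrite linearP; apply: PD.
- move: (PU a i b); rewrite fbimod_gen.unlock [a *> _]fblactE [_ <* b]fbractE.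
  by rewrite mulr1 mul1r.
Qed.

Section BimoduleProjection.
Context {M : bimodType A} (S : M -> Prop).

Lemma bproj_lact a m : bproj S (a *> m) = a *> bproj S m.
Proof. by symmetry; apply: blactE. Qed.

Lemma bproj_ract a m : bproj S (m <* a) = bproj S m <* a.
Proof. by symmetry; apply: bractE. Qed.

Lemma bproj_rel s : S s -> bproj S s = 0.
Proof.
move=> Ss; rewrite -(linear0 (bproj S)); apply/qproj_eq/span_gen.
by exists 1, s, 1; rewrite subr0 lact1 ract1.
Qed.

End BimoduleProjection.

Section BimoduleQuotientLift.
Context {M N : bimodType A} (S : M -> Prop) (f : {linear M -> N}).
Hypotheses (f_lact : forall a m, f (a *> m) = a *> f m)
  (f_ract : forall a m, f (m <* a) = f m <* a) (fS : forall s, S s -> f s = 0).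

Definition bquot_lift : bquot S -> N := qlift f.

(** A bimodule map sends a s b to a f(s) b, so killing the generators kills the whole
    sub-bimodule. *)
Let lift_rel s : sub_bimod_gen S s -> f s = 0.
Proof.
by case=> a [s' [b [Ss' ->]]]; rewrite f_ract f_lact fS // linear0 -ractrE linear0.
Qed.

Lemma bquot_lift_linear : linear bquot_lift.
Proof. exact/qlift_linear/lift_rel. Qed.

Lemma bquot_liftE m : bquot_lift (bproj S m) = f m.
Proof. exact/qliftE/lift_rel. Qed.

Lemma bquot_lift_lact a p : bquot_lift (a *> p) = a *> bquot_lift p.
Proof. by rewrite -[p]qreprK [a *> _]blactE !bquot_liftE f_lact. Qed.

Lemma bquot_lift_ract a p : bquot_lift (p <* a) = bquot_lift p <* a.
Proof. by rewrite -[p]qreprK [_ <* a]bractE !bquot_liftE f_ract. Qed.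

End BimoduleQuotientLift.

End BimoduleMaps.

(** * An explicit bimodule modelling the forms *)

Section QuantumFormsModel.
Context {K : fieldType} (q : K).
Local Notation A := (qplane q).
Local Notation x := (qx q).
Local Notation y := (qy q).

(* The pair (f, g) stands for the form xi f + eta g. *)
Definition form_model : Type := (A * A)%type.
HB.instance Definition _ := GRing.Lmodule.on form_model.
Local Notation N := form_model.

(** The relations of the calculus move x to the right of xi and eta; the summand (q^2 - 1) xi y of x
    eta feeds g into the first component. *)
Definition model_x (w : N) : N :=
  (q ^+ 2 *: (x * w.1) + (q ^+ 2 - 1) *: (y * w.2), q *: (x * w.2)).
Definition model_y (w : N) : N := (q *: (y * w.1), q ^+ 2 *: (y * w.2)).

Let mulZC (b c : K) (a u v : A) :
  b *: (a * (c *: u + v)) = c *: (b *: (a * u)) + b *: (a * v).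
Proof. by rewrite mulPr scalerDr !scalerA [c * b]mulrC. Qed.

Lemma model_x_linear : linear model_x.
Proof.
move=> c [f g] [f' g']; congr pair; rewrite /= ?mulZC //.
by rewrite [c *: (_ + _)]scalerDr addrACA.
Qed.
HB.instance Definition _ :=
  GRing.isLinear.Build K N N *:%R model_x model_x_linear.

Lemma model_y_linear : linear model_y.
Proof. by move=> c [f g] [f' g']; congr pair; rewrite /= mulZC. Qed.
HB.instance Definition _ :=
  GRing.isLinear.Build K N N *:%R model_y model_y_linear.

(** This is the consistency of the form relations with x y = q y x; through [qact] it yields the
    left action on the model. *)
Lemma model_xy w : model_x (model_y w) = q *: model_y (model_x w).
Proof.
case: w => f g; congr pair; rewrite /= ?mulPr -!scalerAr ?scalerDr !scalerA.
  rewrite !mulrA qxy -scalerAl !scalerA; congr (_ *: _ + _ *: _).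
  by rewrite -mulrA mulrC.
by rewrite !mulrA qxy -scalerAl scalerA.
Qed.

Definition model_lact (a : A) (w : N) : N := qact model_x model_y a w.
Definition model_ract (w : N) (b : A) : N := (w.1 * b, w.2 * b).

Lemma model_lact_linearl w : linear (model_lact^~ w).
Proof. exact: qact_linearl model_xy w. Qed.
Lemma model_lact_linearr a : linear (model_lact a).
Proof. exact: qact_linearr model_xy a. Qed.
Lemma model_ract_linearl b : linear (model_ract^~ b).
Proof. by move=> c [f g] [f' g']; congr pair; rewrite /= mulPl. Qed.
Lemma model_ract_linearr w : linear (model_ract w).
Proof. by case: w => f g c a b; congr pair; rewrite /= mulPr. Qed.
Lemma model_lact1 w : model_lact 1 w = w.
Proof. exact: qact1 model_xy w. Qed.
Lemma model_ract1 w : model_ract w 1 = w.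
Proof. by case: w => f g; rewrite /model_ract /= !mulr1. Qed.
Lemma model_lactA a b w : model_lact a (model_lact b w) = model_lact (a * b) w.
Proof. by symmetry; apply: qactM model_xy a b w. Qed.
Lemma model_ractA w a b : model_ract (model_ract w a) b = model_ract w (a * b).
Proof. by rewrite /model_ract /= !mulrA. Qed.

(** Both generators act by combinations of left multiplications on the components, which commute
    with right multiplication by associativity. *)
Lemma model_lract a w b :
  model_lact a (model_ract w b) = model_ract (model_lact a w) b.
Proof.
have ractP c u v : model_ract (c *: u + v) b
    = c *: model_ract u b + model_ract v b by apply: model_ract_linearl.
have lact0 v : model_lact 0 v = 0 := lin0 (model_lact_linearl v).
elim/(@qplane_ind K q): a => [||c a a' IHa IHa'|a IH|a IH].
- by rewrite !lact0 [RHS](lin0 (model_ract_linearl b)).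
- by rewrite !model_lact1.
- by rewrite !model_lact_linearl IHa IHa' ractP.
- rewrite -!model_lactA IH /model_lact !(qact_x model_xy).
  by congr pair; rewrite /= ?mulrDl -!scalerAl -!mulrA.
- rewrite -!model_lactA IH /model_lact !(qact_y model_xy).
  by congr pair; rewrite /= -!scalerAl -!mulrA.
Qed.

HB.instance Definition _ := isBimodule.Build K A N
  model_lact_linearl model_lact_linearr model_ract_linearl model_ract_linearr
  model_lact1 model_ract1 model_lactA model_ractA model_lract.

End QuantumFormsModel.

(** * Coordinates of forms, and the centre *)

Section QuantumForms.
Context {K : fieldType} (q : K).
Local Notation A := (qplane q).
Local Notation x := (qx q).
Local Notation y := (qy q).
Local Notation xi := (qxi q).
Local Notation eta := (qeta q).

Lemma qx_xi : x *> xi = q ^+ 2 *: (xi <* x).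
Proof.
have /eqP := bproj_rel (rel_x_xi q); rewrite linearB linearZ /= subr_eq0.
by rewrite bproj_lact bproj_ract qxi.unlock => /eqP.
Qed.

Lemma qx_eta : x *> eta = q *: (eta <* x) + (q ^+ 2 - 1) *: (xi <* y).
Proof.
have /eqP := bproj_rel (rel_x_eta q).
rewrite linearB linearD /= !linearZ /= subr_eq0.
by rewrite bproj_lact !bproj_ract qxi.unlock qeta.unlock => /eqP.
Qed.

Lemma qy_xi : y *> xi = q *: (xi <* y).
Proof.
have /eqP := bproj_rel (rel_y_xi q); rewrite linearB linearZ /= subr_eq0.
by rewrite bproj_lact bproj_ract qxi.unlock => /eqP.
Qed.

Lemma qy_eta : y *> eta = q ^+ 2 *: (eta <* y).
Proof.
have /eqP := bproj_rel (rel_y_eta q); rewrite linearB linearZ /= subr_eq0.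
by rewrite bproj_lact bproj_ract qeta.unlock => /eqP.
Qed.

Let gen_coord (i : bool) : form_model q := if i then (0, 1) else (1, 0).

(** The map out of the presented bimodule exists because the four relations hold in the model for
    (1, 0) and (0, 1). *)
Definition form_coord : qform q -> form_model q :=
  bquot_lift (S := @qform_rel K q) (fbimod_lift gen_coord).

Lemma model_lact_x w : x *> w = model_x w :> form_model q.
Proof. exact: qact_x (@model_xy K q) w. Qed.

Lemma model_lact_y w : y *> w = model_y w :> form_model q.
Proof. exact: qact_y (@model_xy K q) w. Qed.

Let form_coord_rel s : qform_rel s -> fbimod_lift gen_coord s = 0.
Proof.
case; rewrite (linearB (fbimod_lift gen_coord)); apply/eqP;
  rewrite subr_eq0 ?(linearD (fbimod_lift gen_coord)) !linearZ_LR /=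
    !fbimod_lift_lact !fbimod_lift_ract !fbimod_lift_gen ?model_lact_x ?model_lact_y;
  apply/eqP; congr pair;
  rewrite /= ?mulr1 ?mulr0 ?mul1r ?mul0r ?scaler0 ?addr0 ?add0r //.
Qed.

Let lift_lact := fbimod_lift_lact gen_coord.
Let lift_ract := fbimod_lift_ract gen_coord.

Lemma form_coord_linear : linear form_coord.
Proof. exact: bquot_lift_linear lift_lact lift_ract form_coord_rel. Qed.
HB.instance Definition _ := GRing.isLinear.Build K (qform q) (form_model q) *:%R
  form_coord form_coord_linear.

Lemma form_coord_lact a z : form_coord (a *> z) = a *> form_coord z.
Proof. exact: bquot_lift_lact lift_lact lift_ract form_coord_rel a z. Qed.

Lemma form_coord_ract a z : form_coord (z <* a) = form_coord z <* a.
Proof. exact: bquot_lift_ract lift_lact lift_ract form_coord_rel a z. Qed.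

(** Hence the right coefficients on xi and eta are unique; their existence is [qform_basis]. *)
Lemma form_coordE f g : form_coord (xi <* f + eta <* g) = (f, g).
Proof.
rewrite linearD /= !form_coord_ract.
have liftE u : form_coord (bproj _ u) = fbimod_lift gen_coord u.
  exact: bquot_liftE lift_lact lift_ract form_coord_rel u.
rewrite qxi.unlock qeta.unlock !liftE !fbimod_lift_gen.
by congr pair; rewrite /= ?mul1r ?mul0r ?addr0 ?add0r.
Qed.

(** The right span of xi and eta is also stable on the left, since the relations push x and y
    through; it contains the generators, so it is everything. *)
Lemma qform_basis (z : qform q) : exists f g, z = xi <* f + eta <* g.
Proof.
pose P (z : qform q) := exists f g, z = xi <* f + eta <* g.
have P0 : P 0 by exists 0, 0; rewrite !linear0 addr0.
have PD c u v : P u -> P v -> P (c *: u + v).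
  move=> [f [g ->]] [f' [g' ->]]; exists (c *: f + f'), (c *: g + g').
  by rewrite !ractPr addrACA -scalerDr.
have Pract b u : P u -> P (u <* b).
  move=> [f [g ->]]; exists (f * b), (g * b).
  by rewrite -!ractrE linearD /= !ractrE !ractA.
have Pxi f : P (xi <* f) by exists f, 0; rewrite linear0 addr0.
have Peta f : P (eta <* f) by exists 0, f; rewrite linear0 add0r.
have PDD u v : P u -> P v -> P (u + v) by move=> *; rewrite -[u]scale1r; apply: PD.
have PZ c u : P u -> P (c *: u) by rewrite -[c *: u]addr0 => Pu; apply: PD.
have Plact a u : P u -> P (a *> u).
  elim/(@qplane_ind K q): a u => [||c a b IHa IHb|a IH|a IH] u Pu.
  - by rewrite (lin0 (lact_linearl u)).
  - by rewrite lact1.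
  - by rewrite lactPl; apply: PD; [apply: IHa | apply: IHb].
  (* Once [a *> u] is expanded as xi f + eta g, the product with x is (x xi) f + (x eta) g, and the
     relations apply inside the brackets. *)
  - rewrite -lactA; have [f [g ->]] := IH u Pu; rewrite linearD /= !lract.
    rewrite qx_xi qx_eta; apply: (PDD); apply: Pract; first exact: PZ.
    by apply: PDD; apply: PZ.
  - rewrite -lactA; have [f [g ->]] := IH u Pu; rewrite linearD /= !lract.
    by rewrite qy_xi qy_eta; apply: (PDD); apply/Pract/PZ.
rewrite -[z]qreprK; elim/(@fbimod_ind K A bool): (repr z) => [|c u v|a i b].
- by rewrite linear0.
- by rewrite linearP; apply: PD.
- suff : P (a *> bproj (@qform_rel K q) (fbimod_gen A i) <* b).
    by rewrite -bproj_lact -bproj_ract.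
  apply/Pract/Plact; case: i.
    by move: (Peta 1); rewrite qeta.unlock ract1.
  by move: (Pxi 1); rewrite qxi.unlock ract1.
Qed.

Lemma qform_center0 (q_pow : forall n, (0 < n)%N -> q ^+ n != 1) (z : qform q) :
  bimod_center z -> z = 0.
Proof.
(* Centrality is tested against x, and the equation is read in coordinates. *)
have [f [g ->]] := qform_basis z => /(_ x)/(congr1 form_coord).
rewrite form_coord_lact form_coord_ract form_coordE model_lact_x => -[Ef Eg].
(* The eta-coefficient comes first: the equation for f contains the mixed term (q^2 - 1) (y g),
   which must vanish before k = 2 can be used. *)
have g0 : g = 0 by apply: (qcommx_eq0 (k := 1)) q_pow _ _ _.
have f0 : f = 0.
  by apply: (qcommx_eq0 (k := 2)) q_pow _ _ _; rewrite // -Ef g0 mulr0 scaler0 addr0.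
by rewrite f0 g0 !linear0 addr0.
Qed.

End QuantumForms.

Theorem proposition3p3 (R : realType) (q : R[i]) (q_neq0 : q != 0)
    (q_not_root_of_unity : forall n : nat, (0 < n)%N -> ~~ n.-unity_root q)
    (d : qplane q -> qform q) (d_diff : qdifferential d)
    (sigma : tensor (qform q) (qform q) -> tensor (qform q) (qform q))
    (sigma_braiding : qbraiding sigma)
    (nablaL nablaR : qform q -> tensor (qform q) (qform q)) :
  left_connection d nablaL -> right_connection d nablaR ->
  compatible sigma nablaL nablaR.
Proof.
case: sigma_braiding => -[sigma_lin _ _ _] _ _ _ _ [nablaL_lin _] [nablaR_lin _].
move=> z /qform_center0 -> /= => [|n n_gt0].
  (* At the only central form, 0, all three maps vanish by linearity. *)
  by rewrite (lin0 nablaL_lin) (lin0 nablaR_lin) (lin0 sigma_lin).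
by have := q_not_root_of_unity n n_gt0; rewrite unity_rootE.
Qed.
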